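(* Consider the following four statements, where (A), (B), (C) are each asserted for all uniform clutters. (A) For every uniform clutter $\mathcal{C}$: if $I(\overline{\mathcal{C}})$ has linear quotients, then $\mathcal{C}$ is chordal. (B) For every uniform clutter $\mathcal{C}$: if $\mathcal{C}^+\neq\emptyset$, $\mathcal{C}^+$ is chordal, and $\mathcal{C}-F$ and $\mathcal{C}-v$ are chordal for each $F\in\mathcal{SMS}(\mathcal{C}^+)$ and each $v\in V(\mathcal{C})$, then $\mathcal{SMS}(\mathcal{C})\neq\emptyset$. (C) For every uniform clutter $\mathcal{C}$: if $\mathcal{C}^+=\emptyset$ and $I(\overline{\mathcal{C}})$ has linear quotients, then $\mathcal{C}$ has a free maximal subcircuit. (D) (Simon's Conjecture) Every $d$-skeleton of a simplex is extendably shellable. Then (B) and (C) together imply (A), and (A) implies both (C) and (D).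
   Context: A clutter $\mathcal{C}$ on a finite vertex set $V=V(\mathcal{C})$ is a family of subsets of $V$, called circuits, that are pairwise incomparable under inclusion. For $F\subseteq V$ put $\dim F=|F|-1$. A $d$-clutter ($d$-dimensional uniform clutter) is a clutter all of whose circuits have dimension $d$ (i.e. $d+1$ elements); a uniform clutter is a $d$-clutter for some $d$. Let $\mathcal{C}$ be a $d$-clutter. The complement $\overline{\mathcal{C}}$ is the $d$-clutter on $V$ with circuits $\{F\subseteq V:\dim F=d,\ F\notin\mathcal{C}\}$. Taking $V=[n]=\{1,\dots,n\}$ and $S=K[x_1,\dots,x_n]$ with $K$ a field, $x_F=\prod_{i\in F}x_i$ and $I(\mathcal{C})$ is the ideal of $S$ generated by $\{x_F: F\in\mathcal{C}\}$. A squarefree monomial ideal $I$ has linear quotients if its minimal monomial generators can be ordered $f_1,\dots,f_t$ so that for each $i$ the ideal $\langle f_1,\dots,f_{i-1}\rangle:f_i$ is generated by linear forms (this does not depend on $K$; the zero ideal has linear quotients vacuously). A subset $A\subseteq V$ is a clique of $\mathcal{C}$ if all $(d+1)$-element subsets of $A$ belong to $\mathcal{C}$. The ascent $\mathcal{C}^+$ is the $(d+1)$-clutter on $V$ whose circuits are all cliques of $\mathcal{C}$ with exactly $d+2$ elements. $\mathcal{MS}(\mathcal{C})$ is the set of maximal subcircuits: the $d$-element subsets $e\subseteq V$ contained in some circuit. A free maximal subcircuit is a maximal subcircuit contained in exactly one circuit. $N_{\mathcal{C}}[e]=e\cup\{v\in V: e\cup\{v\}\in\mathcal{C}\}$. A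 maximal subcircuit $e$ is simplicial if $N_{\mathcal{C}}[e]$ is a clique of $\mathcal{C}$; $\mathcal{SMS}(\mathcal{C})$ is the set of simplicial maximal subcircuits. For a set $e\subseteq V$, $\mathcal{C}-e$ is the clutter on $V$ with circuits $\{G\in\mathcal{C}: e\not\subseteq G\}$ (so for a circuit $F$ of $\mathcal{C}$, in particular for $F\in\mathcal{MS}(\mathcal{C}^+)$, $\mathcal{C}-F=\mathcal{C}\setminus\{F\}$). For $v\in V$, $\mathcal{C}-v$ is the clutter on $V\setminus\{v\}$ with circuits $\{G\in\mathcal{C}: v\notin G\}$. $\mathcal{C}$ is chordal if there is a (possibly empty) sequence $e_1,\dots,e_t$ with $e_i\in\mathcal{SMS}(\mathcal{C}_{i-1})$ for $1\le i\le t$, where $\mathcal{C}_0=\mathcal{C}$ and $\mathcal{C}_i=\mathcal{C}_{i-1}-e_i$, such that $\mathcal{C}_t$ has no circuits. A simplex is a simplicial complex with exactly one facet; its $d$-skeleton is the complex of its faces of dimension at most $d$. A shelling of a pure simplicial complex is an ordering $F_1,\dots,F_m$ of its facets such that for all $j<i$ there are $l\in F_i\setminus F_j$ and $k<i$ with $F_i\setminus F_k=\{l\}$. A pure complex $\Delta$ is extendably shellable if any shelling of a subcomplex of $\Delta$ (generated by some of the facets of $\Delta$) can be continued to a shelling of $\Delta$.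
   Formalization: Statement (C) is taken only for clutters with at least one circuit: for the clutter without circuits, C⁺ is empty and the ideal of the complement has linear quotients, but there is no maximal subcircuit, so (C) read literally is false. *)

(* Defs.v *)
From HB Require Import structures.
From mathcomp Require Import all_boot all_order all_algebra.
From mathcomp Require Import mpoly.

Set Implicit Arguments.
Unset Strict Implicit.
Unset Printing Implicit Defensive.

Import GRing.Theory.

(* The vertex set of a clutter is the whole finite type [T].  The dimension
   [d] is part of the type, since the complement of the clutter without
   circuits depends on it. *)
Record dclutter (T : finType) (d : nat) := DClutter {
  circuits :> {set {set T}};
  circuits_uniform : [forall F in circuits, #|F| == d.+1]
}.

HB.instance Definition _ (T : finType) (d : nat) :=
  [isSub for @circuits T d].

Section Clutter.

Variables (T : finType) (d : nat).
Implicit Type C : dclutter T d.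

Lemma card_circuit C (F : {set T}) : F \in circuits C -> #|F| = d.+1.
Proof. by move=> CF; apply/eqP; apply: (forall_inP (circuits_uniform C)). Qed.

Lemma circuits_incomparable C :
  {in circuits C &, forall F G : {set T}, F \subset G -> F = G}.
Proof.
move=> F G CF CG sFG; apply/eqP.
by rewrite eqEcard sFG (card_circuit CF) (card_circuit CG) leqnn.
Qed.

Lemma complement_uniform C :
  [forall F in [set F : {set T} | (#|F| == d.+1) && (F \notin circuits C)],
     #|F| == d.+1].
Proof. by apply/forall_inP=> F; rewrite inE => /andP[]. Qed.

Definition complement C : dclutter T d := DClutter (complement_uniform C).

Definition clique C (A : {set T}) : bool :=
  [forall F : {set T}, (F \subset A) && (#|F| == d.+1) ==> (F \in circuits C)].

Lemma ascent_uniform C :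
  [forall F in [set A : {set T} | (#|A| == d.+2) && clique C A],
     #|F| == d.+2].
Proof. by apply/forall_inP=> F; rewrite inE => /andP[]. Qed.

Definition ascent C : dclutter T d.+1 := DClutter (ascent_uniform C).

(* Maximal subcircuits have dimension [d - 1], that is, [d] elements. *)
Definition max_subcircuits C : {set {set T}} :=
  [set e : {set T} | (#|e| == d) && [exists F in circuits C, e \subset F]].

Definition free_max_subcircuits C : {set {set T}} :=
  [set e in max_subcircuits C | #|[set F in circuits C | e \subset F]| == 1].

Definition closed_nbhd C (e : {set T}) : {set T} :=
  e :|: [set v | v |: e \in circuits C].

Definition simplicial_max_subcircuits C : {set {set T}} :=
  [set e in max_subcircuits C | clique C (closed_nbhd C e)].

Lemma delete_uniform C (e : {set T}) :
  [forall F in [set G in circuits C | ~~ (e \subset G)], #|F| == d.+1].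
Proof. by apply/forall_inP=> F; rewrite inE => /andP[/card_circuit ->]. Qed.

Definition delete C (e : {set T}) : dclutter T d :=
  DClutter (delete_uniform C e).

Lemma delete_vertex_uniform C (v : T) :
  [forall F in [set G : {set {u : T | u != v}} |
                  [set val u | u in G] \in circuits C], #|F| == d.+1].
Proof.
apply/forall_inP=> F; rewrite inE => /card_circuit.
by rewrite card_imset; [move=> -> | exact: val_inj].
Qed.

(* The vertex set of [C - v] is the subtype of the vertices other than [v]. *)
Definition delete_vertex C (v : T) : dclutter {u : T | u != v} d :=
  DClutter (delete_vertex_uniform C v).

Fixpoint simplicial_elimination C (s : seq {set T}) : bool :=
  if s is e :: s' then
    (e \in simplicial_max_subcircuits C) && simplicial_elimination (delete C e) s'
  else circuits C == set0.

Definition chordal C : Prop := exists s, simplicial_elimination C s.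

End Clutter.

Local Open Scope ring_scope.

Section Ideals.

Variable R : comNzRingType.

Definition ideal_span (X : R -> Prop) (p : R) : Prop :=
  exists (k : nat) (a x : 'I_k -> R),
    (forall i, X (x i)) /\ p = \sum_(i < k) a i * x i.

Definition colon (I : R -> Prop) (f p : R) : Prop := I (p * f).

End Ideals.

Section LinearQuotients.

Variables (K : fieldType) (n : nat).
Implicit Types (I : {mpoly K[n]} -> Prop) (s : seq 'X_{1..n}).

Definition monomial_span s : {mpoly K[n]} -> Prop :=
  ideal_span (fun p => exists2 m, m \in s & p = 'X_[m]).

Definition generates s I : Prop := forall p, I p <-> monomial_span s p.

(* Minimality also excludes repetitions in [s]. *)
Definition minimal_monomial_generators I s : Prop :=
  generates s I /\ forall s', subseq s' s -> generates s' I -> s' = s.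

Definition generated_by_linear_forms I : Prop :=
  exists L : {mpoly K[n]} -> Prop,
    (forall p, L p -> p \is 1.-homog) /\ (forall p, I p <-> ideal_span L p).

Definition linear_quotients I : Prop :=
  exists s, minimal_monomial_generators I s /\
    forall i, (i < size s)%N ->
      generated_by_linear_forms
        (colon (monomial_span (take i s)) 'X_[nth 0%MM s i]).

End LinearQuotients.

(* The vertices are numbered by [enum_rank : T -> 'I_#|T|]. *)
Definition squarefree_monomial (K : fieldType) (T : finType) (F : {set T}) :
    {mpoly K[#|T|]} :=
  \prod_(v in F) 'X_(enum_rank v).

Definition circuit_ideal (K : fieldType) (T : finType) (d : nat)
    (C : dclutter T d) : {mpoly K[#|T|]} -> Prop :=
  ideal_span (fun p => exists2 F, F \in circuits C & p = squarefree_monomial K F).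

Arguments circuit_ideal K {T d} C p.

Local Close Scope ring_scope.

Record scomplex (T : finType) := SComplex {
  faces :> {set {set T}};
  faces_down : forall F G : {set T}, G \subset F -> F \in faces -> G \in faces
}.

Section Complex.

Variable T : finType.
Implicit Type D : scomplex T.

Definition facets D : {set {set T}} :=
  [set F in faces D | [forall G in faces D, (F \subset G) ==> (G == F)]].

Definition simplex D : bool := #|facets D| == 1.

Definition pure D : Prop := {in facets D &, forall F G : {set T}, #|F| = #|G|}.

Lemma skeleton_down D (d : nat) (F G : {set T}) :
  G \subset F -> F \in [set F in faces D | #|F| <= d.+1] ->
  G \in [set F in faces D | #|F| <= d.+1].
Proof.
move=> sGF; rewrite !inE => /andP[DF cF].
by rewrite (faces_down sGF DF) (leq_trans (subset_leq_card sGF) cF).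
Qed.

Definition skeleton D (d : nat) : scomplex T := SComplex (@skeleton_down D d).

Lemma generated_down (A : {set {set T}}) (F G : {set T}) :
  G \subset F -> F \in [set F : {set T} | [exists H in A, F \subset H]] ->
  G \in [set F : {set T} | [exists H in A, F \subset H]].
Proof.
move=> sGF; rewrite !inE => /exists_inP[H AH sFH].
by apply/exists_inP; exists H => //; apply: subset_trans sFH.
Qed.

Definition generated_complex (A : {set {set T}}) : scomplex T :=
  SComplex (@generated_down A).

Definition shelling D (s : seq {set T}) : Prop :=
  [/\ pure D, uniq s, s =i facets D &
      forall i j : nat, j < i < size s ->
        exists l : T, l \in nth set0 s i :\: nth set0 s j /\
          exists k : nat, k < i /\ nth set0 s i :\: nth set0 s k = [set l]].

Definition extendably_shellable D : Prop :=
  pure D /\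
  forall (A : {set {set T}}) (s : seq {set T}),
    A \subset facets D -> shelling (generated_complex A) s ->
    exists t : seq {set T}, shelling D (s ++ t).

End Complex.

Definition linear_quotients_imply_chordal (K : fieldType) : Prop :=
  forall (T : finType) (d : nat) (C : dclutter T d),
    linear_quotients (circuit_ideal K (complement C)) -> chordal C.

Definition chordal_ascent_imply_simplicial : Prop :=
  forall (T : finType) (d : nat) (C : dclutter T d),
    circuits (ascent C) != set0 ->
    chordal (ascent C) ->
    (forall F, F \in simplicial_max_subcircuits (ascent C) ->
       chordal (delete C F)) ->
    (forall v : T, chordal (delete_vertex C v)) ->
    simplicial_max_subcircuits C != set0.

(* A clutter without circuits has no maximal subcircuit at all, although its
   ascent is empty and the ideal of its complement has linear quotients; hence
   the hypothesis that [C] has a circuit. *)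
Definition linear_quotients_imply_free (K : fieldType) : Prop :=
  forall (T : finType) (d : nat) (C : dclutter T d),
    circuits C != set0 ->
    circuits (ascent C) = set0 ->
    linear_quotients (circuit_ideal K (complement C)) ->
    free_max_subcircuits C != set0.

Definition simon_conjecture : Prop :=
  forall (T : finType) (D : scomplex T) (d : nat),
    simplex D -> extendably_shellable (skeleton D d).

(* Main.v *)
Require Import Defs.
From mathcomp Require Import all_boot all_order all_algebra.
From mathcomp Require Import mpoly.

(** Everything reduces to a combinatorial form of linear quotients.  For subsets
    [G_1, ..., G_t] of one size, the squarefree monomials of the [G_i], taken in
    this order, have linear quotients if and only if for all [j < i] there are
    [l] in [G_j :\: G_i] and [k < i] with [G_k :\: G_i = [set l]]
    ([quotient_order], [linear_quotientsP]).  The reason is that membership in a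
    monomial ideal is decided monomial by monomial, so a colon ideal of monomials
    is generated by linear forms only if it is generated by variables.  A shelling
    is the same condition on the complements of the facets
    ([quotient_order_setD]).

    Let [e] be a simplicial maximal subcircuit of [C].  The circuits containing
    [e] can be appended, in any order, to a quotient order of the non-circuits of
    [C] ([quotient_order_delete]): a non-circuit [H] is not contained in the
    clique [N[e]], and for [l] in [H] outside [N[e]] the set [l |: e] is an
    earlier non-circuit.  Two circuits through [e] differ in one vertex, so they
    cause no conflict.

    For [linear_quotients_imply_chordal]: linear quotients of the complement are
    inherited by the ascent ([quotient_orderable_ascent], a squarefree
    truncation), by the deletion of a simplicial subcircuit of the ascent
    ([quotient_orderable_delete_ascent]), by the deletion of a vertex
    ([quotient_orderable_delete_vertex]) and by the deletion of a simplicial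
    subcircuit ([quotient_orderable_delete]).  By induction the first three of
    these clutters are chordal.  Hence [C] has a simplicial maximal subcircuit, by
    [chordal_ascent_imply_simplicial] if the ascent has circuits, and otherwise by
    [linear_quotients_imply_free], as free subcircuits are simplicial; its
    deletion is chordal by induction too ([quotient_orderable_chordal]).

    For [linear_quotients_imply_free]: the first subcircuit of a simplicial
    elimination is free when no [d + 2] vertices span a clique
    ([simplicial_free]).

    For [simon_conjecture]: given a partial shelling of a skeleton of the simplex
    on [V], let [C] be the clutter whose non-circuits are the complements in [V]
    of its facets.  In the order of the shelling these form a quotient order, so
    [C] is chordal, and its elimination appends all circuits to that order
    ([quotient_order_extend]); taking complements once more, the shelling is
    continued ([chordal_simon]). *)

Set Implicit Arguments.
Unset Strict Implicit.
Unset Printing Implicit Defensive.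

Import GRing.Theory.

(** * One-element set differences *)

Section OneElementDifferences.

Variable T : finType.
Implicit Types (e F G H : {set T}) (x : T).

Lemma setU1_eq x e G :
  e \subset G -> x \in G -> x \notin e -> #|G| = #|e|.+1 -> x |: e = G.
Proof.
move=> seG Gx ex cG; apply/eqP.
by rewrite eqEcard subUset sub1set Gx seG cardsU1 ex cG leqnn.
Qed.

Lemma setU1D x e G : e \subset G -> x \notin G -> (x |: e) :\: G = [set x].
Proof.
rewrite -setD_eq0 setDUl => /eqP-> Gx; rewrite setU0.
by apply/setDidPl; rewrite disjoints1.
Qed.

Lemma setD1_subset_setU1 x H G : H :\: G = [set x] -> H \subset x |: G.
Proof. by move=> dH; rewrite setUC -subDset dH. Qed.

Lemma setD_subset_setU1 x H G :
  H \subset x |: G -> #|H| = #|G| -> H != G -> H :\: G = [set x].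
Proof.
rewrite setUC -subDset subset1 => /orP[/eqP // | ] + cH; rewrite setD_eq0 => sHG.
by rewrite eqEcard sHG cH leqnn.
Qed.

End OneElementDifferences.

(** * Quotient orders *)

Section QuotientOrders.

Variable T : finType.
Implicit Types (A B e F G H : {set T}) (s t : seq {set T}).

(** For sets of one size, with [G] not in [s], this says that the colon by the
    monomial of [G] of the ideal of [s] is generated by variables. *)
Definition attaches s G : Prop :=
  {in s, forall H, exists2 l, l \in H :\: G &
                   exists2 H', H' \in s & H' :\: G = [set l]}.

Definition quotient_order s : Prop :=
  forall i, i < size s -> attaches (take i s) (nth set0 s i).

Definition quotient_orderable (X : {set {set T}}) : Prop :=
  exists s, [/\ uniq s, s =i X & quotient_order s].

Lemma attaches_cat s t G : attaches s G -> attaches t G -> attaches (s ++ t) G.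
Proof.
move=> sG tG H; rewrite mem_cat.
by case/orP=> [/sG|/tG] [l HGl [H' uH' dH']]; exists l => //; exists H';
  rewrite // mem_cat uH' ?orbT.
Qed.

Lemma quotient_order_rcons s G :
  quotient_order (rcons s G) <-> quotient_order s /\ attaches s G.
Proof.
split=> [sG | [qs sG] i].
  split=> [i lti|]; last first.
    have:= sG (size s); rewrite size_rcons ltnSn nth_rcons ltnn eqxx.
    by rewrite -cats1 takel_cat ?take_size //; apply.
  have:= sG i; rewrite size_rcons ltnS (ltnW lti) nth_rcons lti.
  by rewrite -cats1 takel_cat ?(ltnW lti) //; apply.
rewrite size_rcons ltnS leq_eqVlt nth_rcons => /predU1P[-> | lti].
  by rewrite ltnn eqxx -cats1 takel_cat ?take_size.
by rewrite lti -cats1 takel_cat ?(ltnW lti) //; apply: qs.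
Qed.

(** Two sets obtained from [e] by adding one element differ in one element, so
    the members of [t] attach to each other, whatever their order. *)
Lemma quotient_order_star s t e :
    quotient_order s -> uniq t ->
    {in t, forall G, e \subset G /\ #|G| = #|e|.+1} ->
    {in t, forall G, attaches s G} ->
  quotient_order (s ++ t).
Proof.
move=> qs; elim/last_ind: t => [|t G IHt]; first by rewrite cats0.
rewrite rcons_uniq => /andP[tG Ut] star ats.
have sub_t : {subset t <= rcons t G}.
  by move=> H tH; rewrite mem_rcons inE tH orbT.
have RG : G \in rcons t G by rewrite mem_rcons mem_head.
rewrite -rcons_cat; apply/quotient_order_rcons; split.
  by apply: IHt => // [H /sub_t/star | H /sub_t/ats].
apply: attaches_cat; first exact: ats.
move=> H tH; have [[seG cG] [seH cH]] := (star _ RG, star _ (sub_t _ tH)).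
have dHG : #|H :\: G| == 1.
  rewrite eqn_leq andbC card_gt0 setD_eq0; apply/andP; split.
    apply: contra tG => sHG; suff <- : H = G by [].
    by apply/eqP; rewrite eqEcard sHG cG cH leqnn.
  have := subset_leq_card (setDS H seG).
  by rewrite [in X in _ <= X]cardsD (setIidPr seH) cH subSnn.
have [l dl] := cards1P dHG; exists l; first by rewrite dl set11.
by exists H.
Qed.

(** The witness that attaches [G] to [H] is contained in [G :|: H], so it survives
    the restriction to subsets of a set that contains [G] and [H]. *)
Lemma attaches_filter_subset s A G :
    G \subset A -> attaches s G ->
  attaches [seq H : {set T} <- s | H \subset A] G.
Proof.
move=> sGA sG H; rewrite mem_filter => /andP[sHA /sG[l HGl [H' sH' dH']]].
exists l => //; exists H' => //; rewrite mem_filter sH' andbT.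
apply: subset_trans (setD1_subset_setU1 dH') _; rewrite subUset sub1set sGA andbT.
by case/setDP: HGl => /(subsetP sHA).
Qed.

Lemma quotient_order_filter_subset s A :
  quotient_order s -> quotient_order [seq H : {set T} <- s | H \subset A].
Proof.
elim/last_ind: s => // s G IHs /quotient_order_rcons[qs sG].
rewrite filter_rcons; case: ifP => [sGA|_]; last exact: IHs.
apply/quotient_order_rcons; split; [exact: IHs | exact: attaches_filter_subset].
Qed.

(** This is the combinatorial content of the fact that linear quotients survive
    truncation to the squarefree monomials of the next degree.  List the oversets
    by the first member [G] of [s] that they contain.  Suppose that [H] comes with
    [G] and that [H1] contains an earlier member; let [l] and [G2] attach [G] to
    that member.  Then [l] is not in [H], or else [H] would contain the earlier
    [G2]; hence [l |: G], which contains [G2] and so was listed earlier, differs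
    from [H] in [l] only. *)
Lemma quotient_order_truncation s d :
    {in s, forall G, #|G| = d} -> quotient_order s ->
  quotient_orderable [set H : {set T} | (#|H| == d.+1) &&
                        has (fun G : {set T} => G \subset H) s].
Proof.
elim/last_ind: s => [_ _|s G IHs card_s].
  by exists [::]; split=> // H; rewrite inE andbF.
case/quotient_order_rcons=> qs sG.
have sub_s : {subset s <= rcons s G}.
  by move=> H tH; rewrite mem_rcons inE tH orbT.
have cG : #|G| = d by apply: card_s; rewrite mem_rcons mem_head.
have [t [Ut Et qt]] := IHs (fun H sH => card_s H (sub_s H sH)) qs.
pose N := [set H : {set T} | [&& #|H| == d.+1, G \subset H & H \notin t]].
have NP H : H \in enum N -> [/\ #|H| = d.+1, G \subset H & H \notin t].
  by rewrite mem_enum inE => /and3P[/eqP].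
exists (t ++ enum N); split.
- by rewrite cat_uniq Ut enum_uniq andbT; apply/hasPn=> H /NP[].
- move=> H; rewrite mem_cat mem_enum !inE !Et inE has_rcons.
  by case: (#|H| == _) => //=; case: (G \subset H); case: (has _ _).
apply: (quotient_order_star (e := G)) => //; first exact: enum_uniq.
  by move=> H /NP[cH sGH _]; rewrite cG.
move=> H /NP[cH sGH tH] H1; rewrite Et inE => /andP[/eqP cH1 /hasP[G1 sG1 sGH1]].
have [l /setDP[G1l Gl] [G2 sG2 dG2]] := sG _ sG1.
have sG2l : G2 \subset l |: G := setD1_subset_setU1 dG2.
have Hl : l \notin H.
  apply: contra tH => Hl; rewrite Et inE cH eqxx /=; apply/hasP; exists G2 => //.
  by apply: subset_trans sG2l _; rewrite subUset sub1set Hl.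
exists l; first by rewrite inE Hl (subsetP sGH1).
exists (l |: G); last exact: setU1D.
by rewrite Et inE cardsU1 Gl cG eqxx /=; apply/hasP; exists G2.
Qed.

End QuotientOrders.

Section Preimage.

Variables (T U : finType) (f : U -> T).
Hypothesis f_inj : injective f.

Lemma attaches_preimset (s : seq {set T}) (G : {set T}) :
    {in s, forall H : {set T}, H \subset f @: setT} ->
    attaches s G ->
  attaches [seq f @^-1: (H : {set T}) | H <- s] (f @^-1: G).
Proof.
move=> s_im sG _ /mapP[H sH ->]; have [l HGl [H' sH' dH']] := sG _ sH.
have [u _ Du] : exists2 u, u \in U & l = f u.
  by case/setDP: HGl => /(subsetP (s_im _ sH))/imsetP[u uU ->] _; exists u.
exists u; first by rewrite -preimsetD inE -Du.
exists (f @^-1: H'); first exact: map_f.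
by rewrite -preimsetD dH'; apply/setP=> w; rewrite !inE Du (inj_eq f_inj).
Qed.

Lemma quotient_order_preimset (s : seq {set T}) :
    {in s, forall H : {set T}, H \subset f @: setT} -> quotient_order s ->
  quotient_order [seq f @^-1: (H : {set T}) | H <- s].
Proof.
elim/last_ind: s => // s G IHs s_im /quotient_order_rcons[qs sG].
rewrite map_rcons; apply/quotient_order_rcons; split.
  by apply: IHs => // H sH; apply: s_im; rewrite mem_rcons inE sH orbT.
apply: attaches_preimset => // H sH.
by apply: s_im; rewrite mem_rcons inE sH orbT.
Qed.

End Preimage.

(** * Deleting simplicial subcircuits *)

Section Clutters.

Variables (T : finType) (d : nat).
Implicit Types (C : dclutter T d) (A e F G : {set T}).

Lemma mem_complement C F :
  (F \in circuits (complement C)) = (#|F| == d.+1) && (F \notin circuits C).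
Proof. by rewrite inE. Qed.

Lemma max_subcircuitP C e :
  reflect (#|e| = d /\ exists2 F, F \in circuits C & e \subset F)
          (e \in max_subcircuits C).
Proof.
rewrite inE; apply: (iffP andP) => [[/eqP-> /exists_inP] | [-> exF]] //.
by split=> //; apply/exists_inP.
Qed.

Lemma simplicialP C e :
  reflect (e \in max_subcircuits C /\ clique C (closed_nbhd C e))
          (e \in simplicial_max_subcircuits C).
Proof. by rewrite [e \in simplicial_max_subcircuits C]inE; apply: andP. Qed.

Lemma cliqueP C A :
  reflect (forall F, F \subset A -> #|F| = d.+1 -> F \in circuits C)
          (clique C A).
Proof.
apply: (iffP forallP) => [kA F sFA cF | kA F].
  by have /implyP-> := kA F; rewrite // sFA cF eqxx.
by apply/implyP=> /andP[sFA /eqP]; apply: kA.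
Qed.

Lemma cliquePn C A :
  ~~ clique C A ->
  exists2 F : {set T}, F \subset A & F \in circuits (complement C).
Proof.
case/forallPn=> F; rewrite negb_imply -andbA => /and3P[sFA cF nCF].
by exists F; rewrite ?mem_complement ?cF.
Qed.

(** A non-circuit [H] leaves the clique [N[e]], and a vertex [l] of [H] outside
    [N[e]] gives the non-circuit [l |: e]. *)
Lemma attaches_simplicial C e G s :
    e \in simplicial_max_subcircuits C -> e \subset G -> G \in circuits C ->
    s =i circuits (complement C) ->
  attaches s G.
Proof.
case/simplicialP=> /max_subcircuitP[ce _] /cliqueP kN seG CG Es H.
rewrite Es mem_complement => /andP[/eqP cH nCH].
have /subsetPn[l Hl] : ~~ (H \subset closed_nbhd C e).
  by apply: contra nCH => /kN->.
rewrite !inE => /norP[el nCle].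
have Gl : l \notin G.
  apply: contra nCle => Gl.
  by rewrite (setU1_eq seG Gl el) // ce (card_circuit CG).
exists l; first by rewrite inE Gl.
exists (l |: e); last exact: setU1D.
by rewrite Es mem_complement nCle cardsU1 el ce eqxx.
Qed.

Lemma quotient_order_delete C e s :
    e \in simplicial_max_subcircuits C -> uniq s ->
    s =i circuits (complement C) -> quotient_order s ->
  exists t, [/\ uniq (s ++ t), s ++ t =i circuits (complement (delete C e))
              & quotient_order (s ++ t)].
Proof.
move=> Se Us Es qs; pose N := [set G in circuits C | e \subset G].
have NP G : G \in enum N -> G \in circuits C /\ e \subset G.
  by rewrite mem_enum inE => /andP[].
exists (enum N); split.
- rewrite cat_uniq Us enum_uniq andbT; apply/hasPn=> G /NP[CG _].
  by rewrite Es mem_complement CG andbF.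
- move=> G; rewrite mem_cat mem_enum Es !inE.
  have [/card_circuit->|] := boolP (G \in circuits C); last by rewrite orbF.
  by rewrite eqxx /= negbK.
have /simplicialP[/max_subcircuitP[ce _] _] := Se.
apply: (quotient_order_star (e := e)); rewrite ?enum_uniq //.
  by move=> G /NP[/card_circuit-> ->]; rewrite ce.
by move=> G /NP[CG seG]; apply: attaches_simplicial Se _ _ _.
Qed.

Lemma quotient_orderable_delete C e :
    e \in simplicial_max_subcircuits C ->
    quotient_orderable (circuits (complement C)) ->
  quotient_orderable (circuits (complement (delete C e))).
Proof.
move=> Se [s [Us Es qs]]; have [t ?] := quotient_order_delete Se Us Es qs.
by exists (s ++ t).
Qed.

(** Each step of the elimination is an instance of [quotient_order_delete], as the
    circuits deleted so far have joined the non-circuits. *)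
Lemma quotient_order_extend C es s :
    simplicial_elimination C es -> uniq s ->
    s =i circuits (complement C) -> quotient_order s ->
  exists t, [/\ uniq (s ++ t), s ++ t =i [set G : {set T} | #|G| == d.+1]
              & quotient_order (s ++ t)].
Proof.
elim: es C s => [|e es IHes] C s /=.
  move=> /eqP C0 Us Es qs; exists [::]; rewrite cats0; split=> // G.
  by rewrite Es mem_complement C0 !inE andbT.
case/andP=> Se es_el Us Es qs.
have [t [Ut Et qt]] := quotient_order_delete Se Us Es qs.
have [t' [Ut' Et' qt']] := IHes _ _ es_el Ut Et qt.
by exists (t ++ t'); rewrite catA.
Qed.

Lemma circuit_sub_closed_nbhd C e F :
    #|e| = d -> F \in circuits C -> e \subset F ->
  F \subset closed_nbhd C e.
Proof.
move=> ce CF seF; apply/subsetP=> v Fv; rewrite !inE.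
have [//|ev /=] := boolP (v \in e).
by rewrite (setU1_eq seF Fv ev) // ce (card_circuit CF).
Qed.

Lemma free_max_subcircuit_simplicial C e :
  e \in free_max_subcircuits C -> e \in simplicial_max_subcircuits C.
Proof.
rewrite inE => /andP[Me /cards1P[A EA]]; apply/simplicialP; split=> //.
have onlyA F : F \in circuits C -> e \subset F -> F = A.
  by move=> CF seF; apply/set1P; rewrite -EA inE CF.
have /setP/(_ A) := EA; rewrite !inE eqxx => /andP[CA seA].
apply/cliqueP=> F sFN cF; suff -> : F = A by [].
apply/eqP; rewrite eqEcard cF (card_circuit CA) leqnn andbT.
apply: subset_trans sFN _; apply/subsetP=> v; rewrite !inE.
case/orP=> [/(subsetP seA) // | Cv].
by rewrite -(onlyA _ Cv) ?setU11 ?subsetUr.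
Qed.

(** If two circuits [A], [B] contained [e], then [A] and a vertex of [B] outside
    [A] would span a clique inside [N[e]]. *)
Lemma simplicial_free C e :
    circuits (ascent C) = set0 -> e \in simplicial_max_subcircuits C ->
  e \in free_max_subcircuits C.
Proof.
move=> C0 /simplicialP[Me kN]; rewrite inE Me /=.
have /max_subcircuitP[ce [A CA seA]] := Me.
apply/cards1P; exists A; apply/setP=> B; rewrite !inE.
apply/andP/eqP=> [[CB seB] | ->] //.
apply/eqP; rewrite eqEcard (card_circuit CB) (card_circuit CA) leqnn andbT.
apply/subsetP=> x Bx; apply: contraT => Ax.
have /setP/(_ (x |: A)) := C0; rewrite !inE cardsU1 Ax (card_circuit CA) eqxx /=.
move/negP; case; apply/cliqueP=> F sF cF; move/cliqueP: kN; apply=> //.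
have sN := @circuit_sub_closed_nbhd C e _ ce.
apply: subset_trans sF _; rewrite subUset sub1set sN // andbT.
exact: subsetP (sN _ CB seB) x Bx.
Qed.

End Clutters.

(** * Heredity of linear quotients of the complement *)

Section Heredity.

Variables (T : finType) (d : nat).
Implicit Types (C : dclutter T d) (A e F G : {set T}).

(** The complement of the ascent consists of the sets with one element more that
    contain a non-circuit. *)
Lemma quotient_orderable_ascent C :
    quotient_orderable (circuits (complement C)) ->
  quotient_orderable (circuits (complement (ascent C))).
Proof.
case=> s [Us Es qs].
have card_s : {in s, forall G : {set T}, #|G| = d.+1}.
  by move=> G; rewrite Es => /card_circuit.
have [t [Ut Et qt]] := quotient_order_truncation card_s qs.
exists t; split=> // H; rewrite Et !inE; case: (#|H| == _) => //=.
apply/hasP/idP=> [[G] | nkH].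
  rewrite Es mem_complement => /andP[/eqP cG nCG] sGH.
  by apply: contra nCG => /cliqueP; apply.
by have [G sGH nCG] := cliquePn nkH; exists G; rewrite ?Es.
Qed.

(** Write [N] for the closed neighbourhood of [F] in the ascent, a clique of [C].
    A non-circuit [H] has a vertex [l] outside [N]; then [l |: F] is no clique
    and contains a non-circuit, which differs from [F] in [l] only. *)
Lemma quotient_orderable_delete_ascent C F :
    F \in simplicial_max_subcircuits (ascent C) ->
    quotient_orderable (circuits (complement C)) ->
  quotient_orderable (circuits (complement (delete C F))).
Proof.
case/simplicialP=> /max_subcircuitP[cF [A CA sFA]] /cliqueP kN [s [Us Es qs]].
have [cA kA] : #|A| = d.+2 /\ clique C A by move: CA; rewrite inE => /andP[/eqP].
have CF : F \in circuits C by move/cliqueP: kA; apply.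
set N := closed_nbhd _ _ in kN.
have sAN : A \subset N.
  exact: circuit_sub_closed_nbhd.
(* [N] contains [A], so every [d + 1]-subset of [N] extends inside [N] by a
   vertex, to a circuit of the ascent. *)
have kCN : clique C N.
  apply/cliqueP=> G sGN cG.
  have /subsetPn[x Nx Gx] : ~~ (N \subset G).
    apply/negP=> /(subset_trans sAN)/subset_leq_card.
    by rewrite cA cG ltnn.
  have : x |: G \in circuits (ascent C).
    by apply: kN; rewrite ?subUset ?sub1set ?Nx // cardsU1 Gx cG.
  by rewrite inE => /andP[_ /cliqueP]; apply=> //; apply: subsetUr.
have sF : attaches s F.
  move=> H; rewrite Es mem_complement => /andP[/eqP cH nCH].
  have /subsetPn[l Hl] : ~~ (H \subset N).
    by apply: contra nCH => sHN; move/cliqueP: kCN; apply.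
  rewrite !inE => /norP[Fl]; rewrite cardsU1 Fl cF eqxx /= => nkl.
  exists l; first by rewrite inE Fl.
  have [G sGl nCG] := cliquePn nkl; exists G; first by rewrite Es.
  apply: setD_subset_setU1 => //; first by rewrite (card_circuit nCG) cF.
  by apply: contraTneq nCG => ->; rewrite mem_complement CF andbF.
exists (rcons s F); split.
- by rewrite rcons_uniq Us Es mem_complement CF andbF.
- move=> G; rewrite mem_rcons inE Es !inE negb_and negbK.
  have [-> | neGF] := eqVneq G F; first by rewrite cF eqxx subxx orbT.
  have [CG | //] := boolP (G \in circuits C).
  rewrite (card_circuit CG) eqxx /=; apply/esym/negP=> sFG; case/eqP: neGF.
  by apply/esym/eqP; rewrite eqEcard sFG cF (card_circuit CG) /=.
by apply/quotient_order_rcons.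
Qed.

(** The quotient order of the non-circuits avoiding [v] is a restriction to the
    subsets of the complement of [v]. *)
Lemma quotient_orderable_delete_vertex C v :
    quotient_orderable (circuits (complement C)) ->
  quotient_orderable (circuits (complement (delete_vertex C v))).
Proof.
case=> s [Us Es qs]; pose f := val : {u : T | u != v} -> T.
pose s' := [seq H : {set T} <- s | H \subset [set~ v]].
have s'P H : H \in s' -> f @: (f @^-1: H) = H.
  rewrite mem_filter => /andP[/subsetP sHv _]; apply/setP=> x.
  apply/imsetP/idP=> [[u] | Hx]; first by rewrite inE => ? ->.
  have xv : x != v by have := sHv x Hx; rewrite !inE.
  by exists (Sub x xv : {u : T | u != v}); rewrite ?inE /f /=.
have preK (G : {set {u : T | u != v}}) : f @^-1: (f @: G) = G.
  apply/setP=> u; rewrite inE; exact: mem_imset val_inj.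
exists [seq f @^-1: (H : {set T}) | H <- s']; split.
- rewrite map_inj_in_uniq ?filter_uniq // => H1 H2 /s'P E1 /s'P E2 eqH.
  by rewrite -E1 eqH.
- move=> G; rewrite !inE.
  have -> : (G \in [seq f @^-1: (H : {set T}) | H <- s']) = (f @: G \in s').
    apply/mapP/idP=> [[H sH ->] | sG]; first by rewrite s'P.
    by exists (f @: G).
  rewrite mem_filter Es mem_complement card_imset; last exact: val_inj.
  suff -> : f @: G \subset [set~ v] by [].
  by apply/subsetP=> _ /imsetP[u _ ->]; rewrite !inE (valP u).
apply: quotient_order_preimset; first exact: val_inj.
  by move=> H /s'P <-; apply: imsetS; apply: subsetT.
exact: quotient_order_filter_subset.
Qed.

End Heredity.

(** * Monomial ideals *)

Local Open Scope ring_scope.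

Section IdealSpan.

Variable R : comNzRingType.
Implicit Types (X Y : R -> Prop) (p q : R).

Lemma ideal_span_gen X q x : X x -> ideal_span X (q * x).
Proof.
by move=> Xx; exists 1%N, (fun=> q), (fun=> x); rewrite big_ord1.
Qed.

Lemma ideal_spanD X p q :
  ideal_span X p -> ideal_span X q -> ideal_span X (p + q).
Proof.
case=> [k [a [x [Xx ->]]]] [l [b [y [Xy ->]]]].
exists (k + l)%N, (fun i => match split i with inl j => a j | inr j => b j end).
exists (fun i => match split i with inl j => x j | inr j => y j end).
split=> [i|]; first by case: (split i).
rewrite big_split_ord; congr (_ + _); apply: eq_bigr => i _.
  by rewrite (unsplitK (inl i)).
by rewrite (unsplitK (inr i)).
Qed.

Lemma ideal_span_sum X (I : eqType) (r : seq I) (F : I -> R) :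
  {in r, forall i, ideal_span X (F i)} -> ideal_span X (\sum_(i <- r) F i).
Proof.
move=> XF; rewrite big_seq; elim/big_ind: _ => //; last exact: ideal_spanD.
by exists 0%N, (fun=> 0), (fun=> 0); split=> [[]|]; rewrite ?big_ord0.
Qed.

Lemma sub_ideal_span X Y p :
  (forall x, X x -> Y x) -> ideal_span X p -> ideal_span Y p.
Proof.
move=> sXY [k [a [x [Xx ->]]]]; exists k, a, x.
by split=> // i; apply: sXY.
Qed.

End IdealSpan.

Section MonomialIdeals.

Variables (K : fieldType) (n : nat).
Implicit Types (p q : {mpoly K[n]}) (m : 'X_{1..n}) (s t : seq 'X_{1..n}).

Lemma mem_msuppMX p m m' :
  reflect (exists2 m1, m1 \in msupp p & m' = (m + m1)%MM)
          (m' \in msupp (p * 'X_[m])).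
Proof. by rewrite (perm_mem (msuppMX p m)); apply: mapP. Qed.

Lemma ideal_span_msupp (X : {mpoly K[n]} -> Prop) p m :
    ideal_span X p -> m \in msupp p ->
  exists q x, X x /\ m \in msupp (q * x).
Proof.
case=> [k [a [x [Xx ->]]]] /msupp_sum_le/flatten_mapP[i _ m_i].
by exists (a i), (x i).
Qed.

(** Monomial ideals are graded by the monoid of monomials, so membership is
    decided monomial by monomial, and for one monomial it is divisibility. *)
Lemma monomial_spanP s p :
  monomial_span s p <->
  {in msupp p, forall m, exists2 m', m' \in s & (m' <= m)%MM}.
Proof.
split=> [sp m /(ideal_span_msupp sp)[q [_ [[m1 s_m1 ->]]]] | sp].
  by case/mem_msuppMX=> m2 _ ->; exists m1; rewrite // lem_addr.
rewrite [p]mpolyE; apply: ideal_span_sum => m /sp[m' s_m' le_m'm].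
rewrite -(submK le_m'm) mpolyXD scalerAl.
by apply: ideal_span_gen; exists m'.
Qed.

Lemma monomial_spanX s m :
  monomial_span (K := K) s 'X_[m] <-> exists2 m', m' \in s & (m' <= m)%MM.
Proof.
split=> [/monomial_spanP | sm]; first by apply; apply/mem_msuppXP.
by apply/monomial_spanP=> _ /mem_msuppXP<-.
Qed.

Lemma eq_minimal_generators (I J : {mpoly K[n]} -> Prop) s :
    (forall p, I p <-> J p) ->
  minimal_monomial_generators I s -> minimal_monomial_generators J s.
Proof.
move=> eqIJ [gen min_s]; split=> [p | s' sub_s' gen'].
  by rewrite -eqIJ; apply: gen.
by apply: min_s => // p; rewrite eqIJ; apply: gen'.
Qed.

(** A monomial [m] of [t] is divisible by some [m'] in [s], and [m'] by some
    [m1] in [t]; as [t] is an antichain, [m1 = m' = m].  So a generating list [s]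
    contains [t], and by minimality nothing else. *)
Lemma minimal_generatorsP t s :
    {in t &, forall m m', (m <= m')%MM -> m = m'} ->
  minimal_monomial_generators (monomial_span (K := K) t) s <-> uniq s /\ s =i t.
Proof.
move=> anti_t.
have lem_anti m m' : (m <= m')%MM -> (m' <= m)%MM -> m = m'.
  move=> /mnm_lepP le_m /mnm_lepP le_m'; apply/mnmP=> i.
  by apply/eqP; rewrite eqn_leq le_m le_m'.
have gen_eq s' : s' =i t -> generates s' (monomial_span (K := K) t).
  move=> Es p; split=> /monomial_spanP sp; apply/monomial_spanP=> m /sp[m'].
    by rewrite -Es => *; exists m'.
  by rewrite Es => *; exists m'.
have sub_gen s' : generates s' (monomial_span (K := K) t) -> {subset t <= s'}.
  move=> gen m tm;
  have /gen/monomial_spanX[m' s'm' le_m'm] : monomial_span (K := K) t 'X_[m].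
    by apply/monomial_spanX; exists m; rewrite // lepm_refl.
  have /gen/monomial_spanX[m1 tm1 le_m1m'] : monomial_span (K := K) s' 'X_[m'].
    by apply/monomial_spanX; exists m'; rewrite // lepm_refl.
  have Dm1 : m1 = m by apply: anti_t => //; apply: lepm_trans le_m'm.
  by rewrite (lem_anti m m') // -Dm1.
split=> [[gen min_s] | [Us Es]].
  pose s' := undup [seq m <- s | m \in t].
  have Es' : s' = s.
    apply: min_s; first exact: subseq_trans (undup_subseq _) (filter_subseq _ _).
    apply: gen_eq => m; rewrite mem_undup mem_filter andb_idr //.
    exact: sub_gen.
  split=> [|m]; first by rewrite -Es' undup_uniq.
  by rewrite -Es' mem_undup mem_filter andb_idr //; apply: sub_gen.
split=> [|s' sub_s' /sub_gen s_s']; first exact: gen_eq.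
apply/eqP; rewrite -(size_subseq_leqif sub_s') eqn_leq (size_subseq sub_s') /=.
by apply: uniq_leq_size => // m; rewrite Es; apply: s_s'.
Qed.

End MonomialIdeals.

(** * Linear quotients as a combinatorial property *)

Section SquarefreeMonomials.

Variable T : finType.
Implicit Types (F G H : {set T}) (s : seq {set T}).

Definition set_mnm F : 'X_{1..#|T|} :=
  [multinom (enum_val i \in F : nat) | i < #|T|].

Lemma set_mnmE F (v : T) : set_mnm F (enum_rank v) = (v \in F).
Proof. by rewrite mnmE enum_rankK. Qed.

Lemma set_mnm_leP F (m : 'X_{1..#|T|}) :
  reflect {in F, forall v, 0 < m (enum_rank v)}%N (set_mnm F <= m)%MM.
Proof.
apply: (iffP mnm_lepP) => [le_m v Fv | m_gt0 i].
  by have := le_m (enum_rank v); rewrite set_mnmE Fv.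
rewrite -(enum_valK i) set_mnmE.
by case: (boolP (_ \in F)) => // /m_gt0.
Qed.

Lemma set_mnm_le F G : (set_mnm F <= set_mnm G)%MM = (F \subset G).
Proof.
by apply/set_mnm_leP/subsetP=> sFG v /sFG; rewrite set_mnmE lt0b.
Qed.

Lemma set_mnm_inj : injective set_mnm.
Proof.
by move=> F G eqFG; apply/eqP; rewrite eqEsubset -!set_mnm_le eqFG lepm_refl.
Qed.

Lemma set_mnm_le_setU1 F G (l : T) :
  (set_mnm F <= U_(enum_rank l) + set_mnm G)%MM = (F \subset l |: G).
Proof.
by apply/set_mnm_leP/subsetP=> sF v /sF;
   rewrite mnmDE mnm1E set_mnmE addn_gt0 !lt0b (inj_eq enum_rank_inj) !inE eq_sym.
Qed.

Variable K : fieldType.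

Lemma squarefree_monomialE F : squarefree_monomial K F = 'X_[set_mnm F].
Proof.
rewrite /squarefree_monomial mpolyXE_id (reindex (@enum_rank T)) /=; last first.
  by apply: onW_bij; apply: enum_rank_bij.
rewrite big_mkcond; apply: eq_bigr => v _; rewrite set_mnmE.
by case: (v \in F).
Qed.

Lemma circuit_idealE d (C : dclutter T d) (p : {mpoly K[#|T|]}) :
  circuit_ideal K C p <->
  monomial_span [seq set_mnm F | F <- enum (circuits C)] p.
Proof.
split; apply: sub_ideal_span => x.
  case=> F CF ->; exists (set_mnm F); last exact: squarefree_monomialE.
  by apply: map_f; rewrite mem_enum.
case=> _ /mapP[F CF ->] ->; exists F; first by rewrite mem_enum in CF.
by rewrite squarefree_monomialE.
Qed.

Lemma in_monomial_spanX s m :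
  monomial_span [seq set_mnm F | F <- s] ('X_[m] : {mpoly K[#|T|]}) <->
  exists2 F, F \in s & (set_mnm F <= m)%MM.
Proof.
split=> [/monomial_spanX[_ /mapP[F sF ->]] | [F sF le_Fm]]; first by exists F.
by apply/monomial_spanX; exists (set_mnm F); rewrite ?map_f.
Qed.

(** For [H] in [s], the monomial of [H :\: G] lies in the colon ideal, hence is
    divisible by a variable [l] occurring in a linear form [x] of that ideal;
    as the ideal is monomial, it contains the variable itself, so that some
    member of [s] lies in [l |: G].  Conversely, a monomial of the colon ideal
    is divisible by the variable [l] that the attachment of [G] provides. *)
Lemma colon_linear_attaches s G d :
    {in s, forall H, #|H| = d} -> #|G| = d -> G \notin s ->
  generated_by_linear_forms
    (colon (monomial_span [seq set_mnm F | F <- s])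
           ('X_[set_mnm G] : {mpoly K[#|T|]})) <->
  attaches s G.
Proof.
move=> card_s cG sG; split=> [[L [homL genL]] H sH | attG].
  have : ideal_span L 'X_[set_mnm (H :\: G)].
    apply/genL; rewrite /colon -mpolyXD; apply/in_monomial_spanX.
    exists H => //; apply/set_mnm_leP=> v Hv.
    by rewrite mnmDE !set_mnmE addn_gt0 !lt0b inE Hv andbT orNb.
  case/ideal_span_msupp/(_ (introT (mem_msuppXP _ _ _) erefl))=> q [x [Lx]].
  have [Jx hom_x] : colon (monomial_span [seq set_mnm F | F <- s])
                      ('X_[set_mnm G] : {mpoly K[#|T|]}) x /\ x \is 1.-homog.
    split; last exact: homL.
    by apply/genL; rewrite -[x]mul1r; apply: ideal_span_gen.
  case/msuppM_le/allpairsP=> [[m1 m2] /= [_ x_m2 Dm]].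
  have /eqP := dhomog_mf hom_x x_m2.
  case/mdeg1P=> i /eqP Dm2; pose l := enum_val i.
  have Di : i = enum_rank l by rewrite enum_valK.
  have HGl : l \in H :\: G.
    suff : (0 < set_mnm (H :\: G) i)%N by rewrite Di set_mnmE lt0b.
    by rewrite Dm mnmDE Dm2 mnm1E eqxx addn_gt0 orbT.
  exists l => //; move/monomial_spanP: Jx => /(_ (U_(i) + set_mnm G)%MM).
  case=> [|_ /mapP[F sF ->]].
    by apply/mem_msuppMX; exists m2 => //; rewrite Dm2 addmC.
  rewrite Di set_mnm_le_setU1 => sFlG; exists F => //.
  apply: setD_subset_setU1 => //; first by rewrite card_s ?cG.
  by apply: contraNneq sG => <-.
pose L (p : {mpoly K[#|T|]}) :=
  exists2 l, p = 'X_(enum_rank l) & exists2 F, F \in s & F :\: G = [set l].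
exists L; split=> [_ [l -> _] | p]; first by rewrite dhomogX /= mdeg1.
split=> [/monomial_spanP Jp | /ideal_span_msupp Lp].
  rewrite [p]mpolyE; apply: ideal_span_sum => m p_m.
  have [|_ /mapP[H sH ->] le_H] := Jp (set_mnm G + m)%MM.
    by apply/mem_msuppMX; exists m.
  have [l /setDP[Hl Gl] sGl] := attG H sH.
  have le_lm : (U_(enum_rank l) <= m)%MM.
    move/set_mnm_leP/(_ l Hl): le_H; rewrite mnmDE set_mnmE (negPf Gl) => m_l.
    apply/mnm_lepP=> i; rewrite mnm1E; by case: eqP => [<-|].
  rewrite -(submK le_lm) mpolyXD scalerAl; apply: ideal_span_gen.
  by exists l.
apply/monomial_spanP=> m' /mem_msuppMX[m p_m ->].
have [q [_ [[l -> [F sF dF]]]]] := Lp _ p_m.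
case/mem_msuppMX=> m1 _ ->; exists (set_mnm F); first exact: map_f.
rewrite addmA [(set_mnm G + _)%MM]addmC; apply: lepm_trans (lem_addr _ _).
by rewrite set_mnm_le_setU1 setD1_subset_setU1.
Qed.

(** The circuits form an antichain, so the minimal monomial generators are their
    monomials, each listed once, and only the order remains to be chosen. *)
Lemma linear_quotientsP d (C : dclutter T d) :
  linear_quotients (circuit_ideal K C) <-> quotient_orderable (circuits C).
Proof.
pose t := [seq set_mnm F | F <- enum (circuits C)].
have anti_t : {in t &, forall m m', (m <= m')%MM -> m = m'}.
  move=> _ _ /mapP[F CF ->] /mapP[G CG ->]; rewrite set_mnm_le => sFG.
  by rewrite (@circuits_incomparable _ _ C F G) // -mem_enum.
have minP (m : seq 'X_{1..#|T|}) :
    minimal_monomial_generators (circuit_ideal K C) m <-> uniq m /\ m =i t.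
  split=> [min_m | /(@minimal_generatorsP K _ _ m anti_t) min_m].
    apply/(@minimal_generatorsP K _ _ m anti_t).
    by apply: eq_minimal_generators min_m => p; apply: circuit_idealE.
  by apply: eq_minimal_generators min_m => p; split=> /circuit_idealE.
have stepP s i : uniq s -> s =i circuits C -> (i < size s)%N ->
    generated_by_linear_forms
      (colon (monomial_span (take i (map set_mnm s)))
        ('X_[nth 0%MM (map set_mnm s) i] : {mpoly K[#|T|]})) <->
    attaches (take i s) (nth set0 s i).
  move=> Us Es lti; rewrite -map_take (nth_map set0) //.
  have card_s F : F \in s -> #|F| = d.+1 by rewrite Es => /card_circuit.
  apply: (@colon_linear_attaches _ _ d.+1) => [F /mem_take||].
  - exact: card_s.
  - by apply: card_s; apply: mem_nth.
  by rewrite in_take ?mem_nth // index_uniq ?ltnn.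
split=> [[m [/minP[Um Em] lin]] | [s [Us Es qs]]].
  pose supp (m' : 'X_{1..#|T|}) := [set v | m' (enum_rank v) != 0%N].
  have suppK : cancel set_mnm supp.
    by move=> F; apply/setP=> v; rewrite inE set_mnmE eqb0 negbK.
  have Dm : map set_mnm (map supp m) = m.
    rewrite -map_comp map_id_in // => m'; rewrite Em => /mapP[F _ ->] /=.
    by rewrite suppK.
  have Us : uniq (map supp m) by rewrite -(map_inj_uniq set_mnm_inj) Dm.
  have Es : map supp m =i circuits C.
    by move=> F; rewrite -(mem_map set_mnm_inj) Dm Em mem_map ?mem_enum //;
       apply: set_mnm_inj.
  exists (map supp m); split=> // i lti; apply/stepP => //.
  by rewrite Dm; apply: lin; rewrite -Dm size_map.
exists (map set_mnm s); split.
  apply/minP; rewrite (map_inj_uniq set_mnm_inj) Us; split=> // m.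
  by apply/mapP/mapP=> [] [F]; rewrite ?mem_enum -?Es => sF ->; exists F;
     rewrite ?mem_enum -?Es.
move=> i; rewrite size_map => lti; apply/stepP => //; exact: qs.
Qed.

End SquarefreeMonomials.

Local Close Scope ring_scope.

(** * Chordality *)

Section Chordality.

Variables (T : finType) (d : nat).
Implicit Types (C : dclutter T d) (e F : {set T}).

Lemma chordal_set0 C : circuits C = set0 -> chordal C.
Proof. by move=> C0; exists [::]; rewrite /= C0. Qed.

Lemma chordal_delete C e :
  e \in simplicial_max_subcircuits C -> chordal (delete C e) -> chordal C.
Proof. by move=> Se [s el_s]; exists (e :: s); rewrite /= Se. Qed.

Lemma chordal_simplicial C :
  circuits C != set0 -> chordal C -> simplicial_max_subcircuits C != set0.
Proof.
move=> C0 [[|e s] /= el]; first by rewrite el in C0.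
by case/andP: el => Se _; apply/set0Pn; exists e.
Qed.

Lemma card_delete C e F :
  F \in circuits C -> e \subset F -> #|circuits (delete C e)| < #|circuits C|.
Proof.
move=> CF seF; apply: proper_card; apply/properP; split.
  by apply/subsetP=> G; rewrite inE => /andP[].
by exists F; rewrite // inE CF seF.
Qed.

Lemma max_subcircuits_ascent C F :
  F \in max_subcircuits (ascent C) -> F \in circuits C.
Proof.
case/max_subcircuitP=> cF [A]; rewrite inE => /andP[_ /cliqueP kA] sFA.
exact: kA.
Qed.

End Chordality.

(** The hypothesis joins [chordal_ascent_imply_simplicial] and
    [linear_quotients_imply_free] into one step.  The induction is
    lexicographic: deleting a vertex lowers the number of vertices, the ascent
    keeps it and lowers [#|T| - d], and deleting a subcircuit keeps both and lowers
    the number of circuits. *)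
Lemma quotient_orderable_chordal (T : finType) d (C : dclutter T d) :
    (forall (U : finType) k (E : dclutter U k), circuits E != set0 ->
       quotient_orderable (circuits (complement E)) ->
       (circuits (ascent E) != set0 -> chordal (ascent E)) ->
       (forall F, F \in simplicial_max_subcircuits (ascent E) ->
          chordal (delete E F)) ->
       (forall v : U, chordal (delete_vertex E v)) ->
       simplicial_max_subcircuits E != set0) ->
    quotient_orderable (circuits (complement C)) ->
  chordal C.
Proof.
move=> simp; move: {-1}(#|T|) (erefl #|T|) => n.
elim/ltn_ind: n T d C => n IHn T d.
move: {-1}(n - d) (erefl (n - d)) => m.
elim/ltn_ind: m d => m IHm d Dm C.
move: {-1}(#|circuits C|) (erefl #|circuits C|) => k.
elim/ltn_ind: k C => k IHk C Dk Dn qC.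
have [/chordal_set0 // | nzC] := eqVneq (circuits C) set0.
have /set0Pn[e Se] : simplicial_max_subcircuits C != set0.
  apply: simp => // [nzC1 | F SF | v].
  - apply: (IHm (n - d.+1)) => //; last exact: quotient_orderable_ascent.
    rewrite -Dm ltn_sub2l //; have [F /card_circuit <-] := set0Pn _ nzC.
    by rewrite -Dn max_card.
  - have /max_subcircuits_ascent CF : F \in max_subcircuits (ascent C).
      by case/simplicialP: SF.
    apply: IHk (erefl _) Dn _; last exact: quotient_orderable_delete_ascent.
    by rewrite -Dk; apply: card_delete CF (subxx F).
  apply: IHn (erefl _) _; last exact: quotient_orderable_delete_vertex.
  rewrite -Dn card_sig [X in X < _](cardC1 v) prednK //.
  by apply/card_gt0P; exists v.
apply: (chordal_delete Se); apply: IHk (erefl _) Dn _.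
  have /simplicialP[/max_subcircuitP[_ [F CF seF]] _] := Se.
  by rewrite -Dk; apply: card_delete CF seF.
exact: quotient_orderable_delete.
Qed.

(** * Shellings of skeletons *)

Section Shellings.

Variable T : finType.
Implicit Types (V F G H : {set T}) (s t : seq {set T}) (D : scomplex T).

Lemma quotient_orderP s :
  quotient_order s <->
  forall i j, j < i < size s ->
    exists l : T, l \in nth set0 s j :\: nth set0 s i /\
      exists k, k < i /\ nth set0 s k :\: nth set0 s i = [set l].
Proof.
split=> [qs i j /andP[ltji lti] | qs i lti].
  have s_j : nth set0 s j \in take i s.
    by rewrite -(nth_take _ ltji) mem_nth // size_take lti.
  have [l lij [H /(nthP set0)[k]]] := qs i lti _ s_j.
  rewrite size_take lti => ltki; rewrite nth_take // => <- dki.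
  by exists l; split=> //; exists k.
move=> H /(nthP set0)[j]; rewrite size_take lti => ltji.
rewrite nth_take // => <- {H}.
have [|l [lij [k [ltki dki]]]] := qs i j; first by rewrite ltji.
exists l => //; exists (nth set0 s k) => //.
by rewrite -(nth_take _ ltki) mem_nth // size_take lti.
Qed.

(** Passing to complements in [V] swaps the two sides of a set difference, which
    turns the shelling condition into the one for linear quotients. *)
Lemma quotient_order_setD V s :
    {in s, forall F : {set T}, F \subset V} ->
  quotient_order [seq V :\: F | F <- s] <->
  forall i j, j < i < size s ->
    exists l : T, l \in nth set0 s i :\: nth set0 s j /\
      exists k, k < i /\ nth set0 s i :\: nth set0 s k = [set l].
Proof.
move=> sV.
have dV i j : i < size s -> j < size s ->
    nth set0 (map (setD V) s) j :\: nth set0 (map (setD V) s) i =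
    nth set0 s i :\: nth set0 s j.
  move=> lti ltj; rewrite !(nth_map set0) //.
  have /subsetP sFV := sV _ (mem_nth set0 lti).
  apply/setP=> x; rewrite !inE.
  by case: (boolP (x \in nth set0 s i)) => [/sFV->|]; case: (x \in V);
     rewrite ?andbF ?andbT.
split=> [/quotient_orderP qs i j ij | qs]; last apply/quotient_orderP => i j.
  have [|l [lij [k [ltki dki]]]] := qs i j; first by rewrite size_map.
  case/andP: ij => ltji lti; rewrite dV ?(ltn_trans ltji) // in lij.
  rewrite dV ?(ltn_trans ltki) // in dki.
  by exists l; split=> //; exists k.
rewrite size_map => ij; have [l [lij [k [ltki dki]]]] := qs i j ij.
case/andP: ij => ltji lti; exists l; rewrite dV ?(ltn_trans ltji) //; split=> //.
by exists k; split=> //; rewrite dV //; apply: ltn_trans lti.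
Qed.

Lemma facets_generated (A : {set {set T}}) :
    {in A &, forall F G, #|F| = #|G|} ->
  facets (generated_complex A) = A.
Proof.
move=> eqA; apply/setP=> F; rewrite !inE; apply/andP/idP.
  case=> /exists_inP[G AG sFG] /forall_inP/(_ G).
  rewrite inE sFG => /(_ _)/eqP <- //; apply/exists_inP; by exists G.
move=> AF; split; first by apply/exists_inP; exists F.
apply/forall_inP=> G; rewrite inE => /exists_inP[H AH sGH]; apply/implyP=> sFG.
rewrite eq_sym eqEcard sFG (eqA F H) //; exact: subset_leq_card.
Qed.

Lemma simplex_powerset D : simplex D -> exists V, faces D = powerset V.
Proof.
case/cards1P=> V DV; exists V; apply/setP=> F; rewrite inE.
have : V \in facets D by rewrite DV set11.
rewrite inE => /andP[FV _].
apply/idP/idP=> [DF | sFV]; last exact: faces_down FV.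
have [G /maxsetP[DG maxG] sFG] := @maxset_exists _ (mem (faces D)) F DF.
suff : G \in facets D by rewrite DV => /set1P <-.
rewrite inE; apply/andP; split=> //; apply/forall_inP=> H DH.
by apply/implyP=> /(maxG H DH) ->.
Qed.

(** The minimum covers a simplex of dimension less than [d], which is its own
    [d]-skeleton. *)
Lemma facets_skeleton D d V : faces D = powerset V ->
  facets (skeleton D d) =
  [set F : {set T} | (F \subset V) && (#|F| == minn #|V| d.+1)].
Proof.
move=> DV; apply/setP=> F; rewrite !inE DV inE /=.
apply/andP/andP=> [[/andP[sFV cF] /forall_inP maxF] | [sFV /eqP cF]].
  split=> //; rewrite eqn_leq leq_min cF subset_leq_card //=.
  rewrite leqNgt leq_min; apply/andP=> [[ltFV ltFd]].
  have /subsetPn[x Vx Fx] : ~~ (V \subset F).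
    by apply: contraL ltFV => /subset_leq_card; rewrite -leqNgt.
  have := maxF (x |: F); rewrite !inE DV inE subUset sub1set Vx sFV cardsU1 Fx.
  rewrite ltFd subsetUr => /(_ isT)/eqP/setP/(_ x).
  by rewrite setU11 (negPf Fx).
rewrite sFV cF geq_minr; split=> //; apply/forall_inP=> G.
rewrite !inE DV inE => /andP[sGV cG]; apply/implyP=> sFG.
by rewrite eq_sym eqEcard sFG cF leq_min subset_leq_card.
Qed.

End Shellings.

(** The clutter [C] lives on all of [T], not only on the vertex set [V] of the
    simplex; so an elimination of [C] also orders circuits not contained in [V].
    These are dropped, by [quotient_order_filter_subset]. *)
Lemma chordal_simon :
    (forall (T : finType) d (C : dclutter T d),
       quotient_orderable (circuits (complement C)) -> chordal C) ->
  simon_conjecture.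
Proof.
move=> chord T D d /simplex_powerset[V DV].
have Efacets := facets_skeleton d DV; set r := minn _ _ in Efacets.
have lerV : r <= #|V| by apply: geq_minl.
have facetP F : F \in facets (skeleton D d) <-> F \subset V /\ #|F| = r.
  by rewrite Efacets inE; split=> [/andP[? /eqP] | [-> ->]]; rewrite ?eqxx.
have pureD : pure (skeleton D d) by move=> F G /facetP[_ ->] /facetP[].
split=> // A s sAD [_ Us Es shell_s].
have AP F : F \in A -> F \subset V /\ #|F| = r.
  by move=> AF; apply/facetP; apply: subsetP sAD _ AF.
have {}Es : s =i A.
  by move=> F; rewrite Es facets_generated // => G H /AP[_ ->] /AP[].
have sV : {in s, forall F : {set T}, F \subset V}.
  by move=> F; rewrite Es => /AP[].
have [c0 | [c Dc]] : #|V| - r = 0 \/ exists c, #|V| - r = c.+1.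
  by case: (#|V| - r) => [|c]; [left | right; exists c].
  (* Here [V] is the only facet, and its complement in [V] is empty, so it is
     not a circuit of a clutter. *)
  have Ust : uniq (s ++ enum (facets (skeleton D d) :\: A)).
    rewrite cat_uniq Us enum_uniq andbT; apply/hasPn=> F.
    by rewrite mem_enum inE Es => /andP[].
  have Est : s ++ enum (facets (skeleton D d) :\: A) =i facets (skeleton D d).
    move=> F; rewrite mem_cat mem_enum inE Es.
    by have [/(subsetP sAD)->|] := boolP (F \in A).
  exists (enum (facets (skeleton D d) :\: A)); split=> // i j.
  suff le1 : size (s ++ enum (facets (skeleton D d) :\: A)) <= 1.
    case/andP=> ltji /leq_trans/(_ le1).
    by rewrite ltnS leqNgt (leq_ltn_trans _ ltji).
  apply: (@uniq_leq_size _ _ [:: V]) => // F.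
  rewrite Est mem_seq1 => /facetP[sFV cF].
  by rewrite eqEcard sFV cF -subn_eq0 c0.
have setDK (F : {set T}) : F \subset V -> V :\: (V :\: F) = F.
  by move=> sFV; rewrite setDDr setDv set0U (setIidPr sFV).
have card_setD (F : {set T}) : F \subset V -> (#|V :\: F| == c.+1) = (#|F| == r).
  move=> sFV; rewrite cardsD (setIidPr sFV) -Dc.
  by rewrite eqn_sub2lE ?subset_leq_card.
pose N := [set V :\: F | F in A].
have N_uniform : [forall G in N, #|G| == c.+1].
  apply/forall_inP=> _ /imsetP[F /AP[sFV cF] ->].
  by rewrite card_setD // cF.
pose C := complement (DClutter N_uniform).
pose s' := [seq V :\: F | F <- s].
have Us' : uniq s'.
  rewrite map_inj_in_uniq // => F G /sV sFV /sV sGV eqFG.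
  by rewrite -(setDK F) // eqFG setDK.
have Es' : s' =i circuits (complement C).
  move=> G; rewrite !inE negb_and negbK.
  have -> : (G \in s') = (G \in N).
    by apply/mapP/imsetP=> [] [F sF ->]; exists F; rewrite ?Es // -Es.
  have [NG | _] := boolP (G \in N); last by rewrite orbF; case: (_ == _).
  by rewrite orbT (forall_inP N_uniform).
have qs' : quotient_order s' by apply/quotient_order_setD.
have [|es el_es] := chord T c C; first by exists s'.
have [t' [Ut Et qt]] := quotient_order_extend el_es Us' Es' qs'.
pose t := [seq V :\: G | G <- [seq G : {set T} <- t' | G \subset V]].
have Dst :
    [seq V :\: F | F <- s ++ t] = [seq G : {set T} <- s' ++ t' | G \subset V].
  rewrite filter_cat map_cat; congr (_ ++ _).
    by apply/esym/all_filterP/allP=> _ /mapP[F _ ->]; apply: subsetDl.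
  rewrite -map_comp map_id_in // => G; rewrite mem_filter => /andP[sGV _].
  exact: setDK.
have stV : {in s ++ t, forall F : {set T}, F \subset V}.
  by move=> F; rewrite mem_cat => /orP[/sV | /mapP[G _ ->]]; rewrite ?subsetDl.
exists t; split=> //.
- apply: (@map_uniq _ _ (fun F => V :\: F)); rewrite Dst.
  exact: filter_uniq.
- move=> F; apply/idP/idP=> [stF | /facetP[sFV cF]].
    apply/facetP; have sFV := stV F stF; split=> //; apply/eqP; rewrite -card_setD //.
    have : V :\: F \in [seq V :\: F | F <- s ++ t] by apply: map_f.
    by rewrite Dst mem_filter Et inE => /andP[].
  have : V :\: F \in [seq V :\: F | F <- s ++ t].
    by rewrite Dst mem_filter Et inE subsetDl card_setD // cF eqxx.
  by case/mapP=> G /[dup] stG /stV sGV eqFG; rewrite -(setDK F) // eqFG setDK.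
apply/(quotient_order_setD stV); rewrite Dst.
exact: quotient_order_filter_subset.
Qed.

Theorem corollary4p16 (K : fieldType) :
  (chordal_ascent_imply_simplicial -> linear_quotients_imply_free K ->
     linear_quotients_imply_chordal K) /\
  (linear_quotients_imply_chordal K ->
     linear_quotients_imply_free K /\ simon_conjecture).
Proof.
split=> [ascB freeC T d C /linear_quotientsP | chordA].
  apply: quotient_orderable_chordal => U k E nzE qE chA chF chv.
  have [A0 | nzA] := eqVneq (circuits (ascent E)) set0; last first.
    by apply: ascB => //; apply: chA.
  have /set0Pn[e fe] : free_max_subcircuits E != set0.
    by apply: freeC => //; apply/linear_quotientsP.
  by apply/set0Pn; exists e; apply: free_max_subcircuit_simplicial.
split=> [T d C nzC C0 lqC |].
  have /set0Pn[e Se] := chordal_simplicial nzC (chordA _ _ _ lqC).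
  by apply/set0Pn; exists e; apply: simplicial_free.
by apply: chordal_simon => T d C qC; apply: chordA; apply/linear_quotientsP.
Qed.
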